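(* Let $\mu$ be a symmetric non-atomic Borel probability measure on $[0,1]$, i.e. $\mu([0,x])=\mu([1-x,1])$ for all $x\in[0,1]$. Then the Neumann eigenfunctions $f_{N,m}$ ($m\in\mathbb{N}_0$) are either symmetric or antisymmetric, that is, for each $m$ either $$f_{N,m}(x)=f_{N,m}(1-x)\ \text{ for all }x\in[0,1]\qquad\text{or}\qquad f_{N,m}(x)=-f_{N,m}(1-x)\ \text{ for all }x\in[0,1].$$
   Context: Derivatives with respect to a measure: for a non-atomic Borel probability measure $\nu$ on $[0,1]$ and $f\colon[0,1]\to\mathbb{R}$, a function $h\in L_2([0,1],\nu)$ is the $\nu$-derivative of $f$, written $\frac{df}{d\nu}$, if $f(x)=f(0)+\int_0^x h\,d\nu$ for all $x\in[0,1]$. $H^1(\nu)$ is the space of functions possessing a $\nu$-derivative; such functions are continuous. For the Lebesgue measure the derivative is written $f'$. $H^2(\lambda,\mu)$ (index $\lambda$: Lebesgue measure) is the space of all $f$ possessing a Lebesgue derivative $f'$ (that is, $f'$ is square-integrable with respect to Lebesgue measure and $f(x)=f(0)+\int_0^x f'(t)\,dt$ for all $x\in[0,1]$) that belongs to $H^1(\mu)$ (so $f'$ is taken to be the continuous representative). A Neumann eigenvalue is a real $\Lambda$ such that there is a non-zero $f\in H^2(\lambda,\mu)$ with $\frac{d}{d\mu}f'=-\Lambda f$ and $f'(0)=f'(1)=0$. The Neumann eigenvalues form a strictly increasing sequence $0=\lambda_{N,0}<\lambda_{N,1}<\cdots\to\infty$; they are exactly the squares of the non-negative zeros of $\sin_\mu^N(z)=\sum_{n\ge0}(-1)^n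 p_{2n+1}(1)z^{2n+1}$. The eigenfunction for $\lambda_{N,m}$ is (normalized as) $f_{N,m}(x)=c_{\lambda,\mu}(\sqrt{\lambda_{N,m}},x)$, where $c_{\lambda,\mu}(z,x)=\sum_{n\ge0}(-1)^n z^{2n}p_{2n}(x)$. Here $p_0(x)=1$ and, for $n\ge1$, $p_n(x)=\int_0^x p_{n-1}\,d\mu$ if $n$ is odd, $p_n(x)=\int_0^x p_{n-1}(t)\,dt$ if $n$ is even. *)

(* Defs.v *)
From HB Require Import structures.
From mathcomp Require Import all_boot all_order all_algebra.
From mathcomp Require Import all_classical all_reals all_analysis.
Set Implicit Arguments.
Unset Strict Implicit.
Unset Printing Implicit Defensive.
Import Order.TTheory GRing.Theory Num.Theory.
Import numFieldNormedType.Exports.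
Local Open Scope classical_set_scope.
Local Open Scope ring_scope.

(* A measure on [0,1] is a Borel measure on R of which only the trace on [0,1]
   is used; a function on [0,1] is a function R -> R of which only the values
   on [0,1] are used. *)

Notation borel_measure R := {measure set (measurableTypeR R) -> \bar R}.

Definition on_unit_interval (R : realType)
    (mu : probability (measurableTypeR R) R) : Prop :=
  mu `[0, 1]%classic = 1%E.

Definition nonatomic (R : realType) (nu : borel_measure R) : Prop :=
  forall x : R, nu [set x] = 0%E.

Definition symmetric_measure (R : realType) (nu : borel_measure R) : Prop :=
  forall x : R, 0 <= x <= 1 -> nu `[0, x]%classic = nu `[1 - x, 1]%classic.

Definition L2_unit (R : realType) (nu : borel_measure R) (h : R -> R) : Prop :=
  measurable_fun (`[0, 1]%classic : set (measurableTypeR R)) h /\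
  nu.-integrable (`[0, 1]%classic : set (measurableTypeR R))
    (fun x => (h x ^+ 2)%:E).

Definition is_measure_derivative (R : realType) (nu : borel_measure R)
    (f h : R -> R) : Prop :=
  L2_unit nu h /\
  forall x : R, 0 <= x <= 1 -> f x = f 0 + \int[nu]_(t in `[0, x]%classic) h t.

Definition H1 (R : realType) (nu : borel_measure R) (f : R -> R) : Prop :=
  exists h : R -> R, is_measure_derivative nu f h.

(* [is_H2 mu f f'] : f belongs to H^2(lambda, mu), with f' the representative
   of its Lebesgue derivative that belongs to H^1(mu) (the continuous one). *)
Definition is_H2 (R : realType) (mu : borel_measure R) (f f' : R -> R) : Prop :=
  is_measure_derivative lebesgue_measure f f' /\ H1 mu f'.

Definition neumann_eigenvalue (R : realType) (mu : borel_measure R) (L : R) : Prop :=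
  exists f f' : R -> R,
    [/\ exists2 x : R, 0 <= x <= 1 & f x != 0,
        is_H2 mu f f',
        is_measure_derivative mu f' (fun x => - L * f x),
        f' 0 = 0 & f' 1 = 0].

(* [lam m] is lambda_{N,m}. *)
Definition neumann_eigenvalue_sequence (R : realType) (mu : borel_measure R)
    (lam : R^nat) : Prop :=
  (forall i j : nat, (i < j)%N -> lam i < lam j) /\
  range lam = [set L | neumann_eigenvalue mu L].

Fixpoint p_fun (R : realType) (mu : borel_measure R) (n : nat) (x : R) : R :=
  match n with
  | 0%N => 1
  | n'.+1 => if odd n'.+1
             then \int[mu]_(t in `[0, x]%classic) p_fun mu n' t
             else \int[lebesgue_measure]_(t in `[0, x]%classic) p_fun mu n' t
  end.

Definition c_fun (R : realType) (mu : borel_measure R) (z x : R) : R :=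
  limn (series (fun n : nat =>
    (-1) ^+ n * z ^+ (2 * n) * p_fun mu (2 * n) x)).

Definition neumann_eigenfunction (R : realType) (mu : borel_measure R)
    (lam : R^nat) (m : nat) (x : R) : R :=
  c_fun mu (Num.sqrt (lam m)) x.

(* Main.v *)
(* For L > 0, iterating the pair of integral equations satisfied by an
   eigenfunction f gives f = f(0) * (sum of (-L)^k p_{2k}, k < n) plus a
   remainder bounded by sup|f| * (L x)^n / n!, so the normalized eigenfunction
   is c = f / f(0). As mu is symmetric, f(1 - x) solves the same equations, and
   f'(1) = 0 supplies its initial condition; hence f(1 - x) = f(1) c(x). At
   x = 0 and x = 1 this forces f(0)^2 = f(1)^2. For L <= 0 the square root of L
   is 0 in Rocq and c = 1. *)

Require Import Defs.
From HB Require Import structures.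
From mathcomp Require Import all_boot all_order all_algebra.
From mathcomp Require Import all_classical all_reals all_analysis.
From mathcomp Require Import measurable_realfun ring lra.
Set Implicit Arguments.
Unset Strict Implicit.
Unset Printing Implicit Defensive.
Import Order.TTheory GRing.Theory Num.Theory.
Import numFieldNormedType.Exports.
Local Open Scope classical_set_scope.
Local Open Scope ring_scope.

Local Notation segment R a b := (`[a%R, b%R]%classic : set (measurableTypeR R)).

(** * Bounded measurable functions on [0,1] and their indefinite integrals *)

Section BoundedMeasurable.
Context {R : realType}.
Implicit Types (h g : R -> R) (x : R).

Local Notation unit_itv := (segment R 0 1).

(** This class is integrable for every measure finite on [0,1], hence for [mu] and for Lebesgue
    measure at once. It is stable under linear combinations and indefinite integration, so it
    contains every [p_fun mu n] and every eigenfunction. *)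
Definition bounded_measurable h : Prop :=
  measurable_fun unit_itv h /\
  exists M : R, forall x, 0 <= x <= 1 -> `|h x| <= M.

Lemma bounded_measurable_cst (c : R) : bounded_measurable (fun=> c).
Proof. by split=> //; exists `|c|. Qed.

Lemma bounded_measurableD h g : bounded_measurable h -> bounded_measurable g ->
  bounded_measurable (fun x => h x + g x).
Proof.
move=> [mh [M hM]] [mg [N gN]]; split; first exact: measurable_funD.
exists (M + N) => x x01; apply: (le_trans (ler_normD _ _)).
by apply: lerD; [exact: hM | exact: gN].
Qed.

Lemma bounded_measurableZ (c : R) h : bounded_measurable h ->
  bounded_measurable (fun x => c * h x).
Proof.
move=> [mh [M hM]]; split; first exact: measurable_funM.
by exists (`|c| * M) => x x01; rewrite normrM ler_wpM2l ?hM.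
Qed.

Lemma bounded_measurable_sum (c : R ^nat) (q : nat -> R -> R) n :
  (forall k, bounded_measurable (q k)) ->
  bounded_measurable (fun x => \sum_(k < n) c k * q k x).
Proof.
move=> bq; elim: n => [|n IH].
  rewrite (_ : (fun _ => _) = (fun=> 0)); first exact: bounded_measurable_cst.
  by apply/funext => x; rewrite big_ord0.
rewrite (_ : (fun _ => _) =
    (fun x => \sum_(k < n) c k * q k x + c n * q n x)); last first.
  by apply/funext => x; rewrite big_ord_recr.
by apply: bounded_measurableD => //; exact: bounded_measurableZ.
Qed.

Lemma eq_bounded_measurable {h g} : (forall x, 0 <= x <= 1 -> h x = g x) ->
  bounded_measurable h -> bounded_measurable g.
Proof.
move=> hg [mh [M hM]]; split; last by exists M => x x01; rewrite -hg// hM.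
apply: eq_measurable_fun mh => x; rewrite inE/= in_itv/=; exact: hg.
Qed.

Lemma subset_unit_itv (a b : R) : 0 <= a -> b <= 1 ->
  `[a, b]%classic `<=` `[0, 1]%classic.
Proof.
move=> a0 b1 t /=; rewrite !in_itv/= => /andP[t0 t1].
by rewrite (le_trans a0)//= (le_trans t1).
Qed.

Section FiniteMeasure.
Context {nu : borel_measure R} (nu_fin : (nu unit_itv < +oo)%E).

Lemma bounded_measurable_integrable h : bounded_measurable h ->
  nu.-integrable unit_itv (EFin \o h).
Proof.
move=> [mh [M hM]]; apply: measurable_bounded_integrable => //.
exists M; split; first exact: num_real.
move=> N MN x /=; rewrite in_itv/= => x01.
by rewrite (le_trans (hM _ _))// ltW.
Qed.

Lemma integrable_sub_unit h (a b : R) : 0 <= a -> b <= 1 ->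
  nu.-integrable unit_itv (EFin \o h) ->
  nu.-integrable (segment R a b) (EFin \o h).
Proof.
move=> a0 b1; apply: integrableS => //; exact: subset_unit_itv.
Qed.

Lemma RintegralD_unit h g x : x <= 1 ->
  bounded_measurable h -> bounded_measurable g ->
  \int[nu]_(t in `[0, x]) (h t + g t) =
  \int[nu]_(t in `[0, x]) h t + \int[nu]_(t in `[0, x]) g t.
Proof.
by move=> x1 bh bg; rewrite RintegralD//;
  apply: integrable_sub_unit => //; exact: bounded_measurable_integrable.
Qed.

Lemma RintegralZ_unit (c : R) h x : x <= 1 -> bounded_measurable h ->
  \int[nu]_(t in `[0, x]) (c * h t) = c * \int[nu]_(t in `[0, x]) h t.
Proof.
by move=> x1 bh; rewrite RintegralZl//;
  apply: integrable_sub_unit => //; exact: bounded_measurable_integrable.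
Qed.

Lemma Rintegral_sum_unit (c : R ^nat) (q : nat -> R -> R) n x : x <= 1 ->
  (forall k, bounded_measurable (q k)) ->
  \int[nu]_(t in `[0, x]) (\sum_(k < n) c k * q k t) =
  \sum_(k < n) c k * \int[nu]_(t in `[0, x]) q k t.
Proof.
move=> x1 bq; elim: n => [|n IH].
  under eq_Rintegral do rewrite big_ord0.
  by rewrite big_ord0 Rintegral_cst// mul0r.
under eq_Rintegral do rewrite big_ord_recr/=.
rewrite RintegralD_unit//; last exact: bounded_measurableZ.
  by rewrite IH RintegralZ_unit// big_ord_recr.
exact: bounded_measurable_sum.
Qed.

Lemma fin_num_unit x : x <= 1 -> nu `[0, x]%classic \is a fin_num.
Proof.
move=> x1; rewrite ge0_fin_numE//; apply: le_lt_trans nu_fin.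
by apply: le_measure; rewrite ?inE//; exact: subset_unit_itv.
Qed.

Lemma Rintegral_le_cst h x (C : R) : x <= 1 -> bounded_measurable h ->
  (forall t, 0 <= t <= x -> `|h t| <= C) ->
  `|\int[nu]_(t in `[0, x]) h t| <= C * fine (nu `[0, x]%classic).
Proof.
move=> x1 bh hC.
have ih : nu.-integrable (segment R 0 x) (EFin \o h).
  by apply: integrable_sub_unit => //; exact: bounded_measurable_integrable.
apply: le_trans (le_normr_Rintegral _ ih) _ => //.
rewrite -Rintegral_cst//; apply: le_Rintegral => //.
- exact: (integrable_norm ih).
- apply: integrable_sub_unit => //; apply: bounded_measurable_integrable.
  exact: bounded_measurable_cst.
Qed.

(** The integral of a nonnegative function over [0,x] is nondecreasing in x, and monotone functions
    are measurable. *)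
Lemma measurable_Rintegral_ge0 h : nu.-integrable unit_itv (EFin \o h) ->
  (forall t, 0 <= t <= 1 -> 0 <= h t) ->
  measurable_fun unit_itv (fun x => \int[nu]_(t in `[0, x]) h t).
Proof.
move=> ih h0.
(* The sign of [h] is known on [0,1] only; capping the endpoint at 1 makes the function monotone on
   the whole line without changing it on [0,1]. *)
pose F x := \int[nu]_(t in `[0, Num.min x 1]) h t.
apply: (eq_measurable_fun F) => [x|].
  rewrite inE/= in_itv/= => /andP[_ x1].
  by rewrite /F min_l.
apply: nondecreasing_measurable => // x y xy; rewrite /F.
have m1 (z : R) : Num.min z 1 <= 1 by rewrite ge_min lexx orbT.
apply: fine_le.
- exact: integrable_fin_num (integrable_sub_unit _ (m1 x) ih).
- exact: integrable_fin_num (integrable_sub_unit _ (m1 y) ih).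
- apply: ge0_subset_integral => //=.
  + exact/measurable_int/(integrable_sub_unit _ (m1 y) ih).
  + move=> t; rewrite in_itv/= => /andP[t0 t1].
    by rewrite lee_fin h0// t0/= (le_trans t1).
  + move=> t /=; rewrite !in_itv/= => /andP[-> /= t1].
    apply: (le_trans t1); rewrite le_min !ge_min xy lexx/=.
    by rewrite orbT.
Qed.

(** Measurability reduces to the monotone case by writing h as (h + |h|) - |h|, a difference of
    nonnegative functions. The integral of |h| over [0,1] is a bound. *)
Lemma bounded_measurable_Rintegral h : nu.-integrable unit_itv (EFin \o h) ->
  bounded_measurable (fun x => \int[nu]_(t in `[0, x]) h t).
Proof.
move=> ih; have ihn : nu.-integrable unit_itv (EFin \o (fun t => `|h t|)).
  exact: (integrable_norm ih).
have ihD : nu.-integrable unit_itv (EFin \o (fun t => h t + `|h t|)).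
  exact: (integrableD _ ih ihn).
split; last first.
  exists (\int[nu]_(t in `[0, 1]) `|h t|) => x /andP[x0 x1].
  have ix := integrable_sub_unit (lexx 0) x1 ih.
  apply: le_trans (le_normr_Rintegral _ ix) _ => //.
  apply: fine_le.
  - exact: integrable_fin_num (integrable_sub_unit (lexx 0) x1 ihn).
  - exact: integrable_fin_num ihn.
  - apply: ge0_subset_integral => //=; first exact: measurable_int ihn.
    exact: subset_unit_itv.
apply: (eq_measurable_fun (fun x => \int[nu]_(t in `[0, x]) (h t + `|h t|) -
   \int[nu]_(t in `[0, x]) `|h t|)) => [x|].
  rewrite inE/= in_itv/= => /andP[_ x1].
  by rewrite RintegralD ?addrK//; exact: integrable_sub_unit.
apply: measurable_funB; apply: measurable_Rintegral_ge0 => // t _.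
by rewrite -lerBlDl sub0r -normrN ler_norm.
Qed.

Lemma L2_unit_integrable h : L2_unit nu h ->
  nu.-integrable unit_itv (EFin \o h).
Proof.
move=> [mh ih2].
apply: (@le_integrable _ _ _ nu unit_itv _ (EFin \o h)
  (fun x => (1 + h x ^+ 2)%:E)) => //.
- exact/measurable_EFinP.
- move=> x _; rewrite /= lee_fin [leRHS]ger0_norm ?addr_ge0 ?sqr_ge0//.
  rewrite -(real_normK (num_real (h x))).
  (* From (|h| - 1)^2 >= 0 one gets |h| <= 1 + h^2, and constants are integrable since the measure
     is finite. *)
  have := sqr_ge0 (`|h x| - 1); have := normr_ge0 (h x); nra.
- have i1 := bounded_measurable_integrable (bounded_measurable_cst 1).
  exact: (integrableD _ i1 ih2).
Qed.

End FiniteMeasure.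

End BoundedMeasurable.

(** * Lebesgue integrals of powers and lengths of intervals *)

Section PowerBounds.
Context {R : realType}.

Lemma Rintegral_exprn (n : nat) (x : R) : 0 <= x ->
  \int[lebesgue_measure]_(t in `[0, x]) t ^+ n = x ^+ n.+1 / n.+1%:R.
Proof.
(* The fundamental theorem of calculus is applied on a nondegenerate interval, so x = 0 is treated
   apart. *)
rewrite le_eqVlt => /predU1P[<-|x0].
  by rewrite set_itv1 Rintegral_set1 expr0n mul0r.
rewrite /Rintegral.
rewrite (@continuous_FTC2 _ _ (fun t : R => t ^+ n.+1 / n.+1%:R))//=.
- by rewrite expr0n/= mul0r subr0.
- by apply: continuous_subspaceT; exact: exprn_continuous.
- split.
  + move=> t _; apply: derivableM; first exact: exprn_derivable.
    exact: derivable_cst.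
  + apply: cvg_at_right_filter; apply: cvgM; last exact: cvg_cst.
    exact: exprn_continuous.
  + apply: cvg_at_left_filter; apply: cvgM; last exact: cvg_cst.
    exact: exprn_continuous.
- move=> t _; rewrite derive1Mr; last exact: exprn_derivable.
  by rewrite exp_derive1 -[_ *: _]/(_ * _) mulrAC divff ?mul1r ?pnatr_eq0.
Qed.

Lemma lebesgue_measure_0x (x : R) : 0 <= x ->
  (lebesgue_measure : borel_measure R) (segment R 0 x) = x%:E.
Proof.
by move=> x0; rewrite [LHS]lebesgue_measure_itv/= lte_fin;
  case: ltgtP x0 => //= [_|<-]; rewrite ?oppr0 ?adde0.
Qed.

Lemma lebesgue_unit_fin :
  ((lebesgue_measure : borel_measure R)
     (segment R 0 1) < +oo)%E.
Proof. by rewrite lebesgue_measure_0x// ltry. Qed.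

End PowerBounds.

(** * The iterated integrals [p_fun] *)

Section Series.
Context {R : realType} (mu : borel_measure R).
Hypothesis mu1 : mu (segment R 0 1) = 1%E.

Let mu_fin : (mu (segment R 0 1) < +oo)%E.
Proof. by rewrite mu1 ltry. Qed.

Lemma p_funS (n : nat) (x : R) : p_fun mu n.+1 x =
  if odd n then \int[lebesgue_measure]_(t in `[0, x]) p_fun mu n t
  else \int[mu]_(t in `[0, x]) p_fun mu n t.
Proof. by rewrite [LHS]/=; case: (odd n). Qed.

Lemma p_fun_odd (k : nat) (x : R) :
  p_fun mu (2 * k).+1 x = \int[mu]_(t in `[0, x]) p_fun mu (2 * k) t.
Proof. by rewrite p_funS mul2n odd_double. Qed.

Lemma p_fun_even (k : nat) (x : R) : p_fun mu (2 * k.+1) x =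
  \int[lebesgue_measure]_(t in `[0, x]) p_fun mu (2 * k).+1 t.
Proof. by rewrite mulnS add2n p_funS /= mul2n odd_double. Qed.

Lemma bounded_measurable_p_fun (n : nat) : bounded_measurable (p_fun mu n).
Proof.
elim: n => [|n IH]; first exact: bounded_measurable_cst.
apply: (eq_bounded_measurable (fun x _ => esym (p_funS n x))).
case: (odd n); apply: bounded_measurable_Rintegral;
  apply: bounded_measurable_integrable => //; exact: lebesgue_unit_fin.
Qed.

(** * Series expansion of a solution with vanishing initial slope *)

Section NeumannSolution.
Variables (L : R) (f f' : R -> R).
Hypotheses (bf : bounded_measurable f) (bf' : bounded_measurable f').
Hypothesis fE : forall x : R, 0 <= x <= 1 ->
  f x = f 0 + \int[lebesgue_measure]_(t in `[0, x]) f' t.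
Hypothesis f'E : forall x : R, 0 <= x <= 1 ->
  f' x = - L * \int[mu]_(t in `[0, x]) f t.

(** [s n] and [t n] are the Picard iterates for the solution with initial value 1 and for its
    derivative: integrating [s n] against [mu] gives [t n], and integrating [t n] against Lebesgue
    measure gives [s n.+1]. *)
Let s n x := \sum_(k < n) (- L) ^+ k * p_fun mu (2 * k) x.
Let t n x := \sum_(k < n) (- L) ^+ k.+1 * p_fun mu (2 * k).+1 x.

Let bs n : bounded_measurable (s n).
Proof.
exact: (bounded_measurable_sum _ _ (fun k => bounded_measurable_p_fun (2 * k))).
Qed.

Let bt n : bounded_measurable (t n).
Proof.
exact: (bounded_measurable_sum (fun k => (- L) ^+ k.+1) _
  (fun k => bounded_measurable_p_fun (2 * k).+1)).
Qed.

Let tE n x : x <= 1 -> t n x = - L * \int[mu]_(y in `[0, x]) s n y.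
Proof.
move=> x1; rewrite (Rintegral_sum_unit mu_fin _ _ x1
  (fun k => bounded_measurable_p_fun (2 * k))).
by rewrite mulr_sumr; apply: eq_bigr => k _; rewrite exprS -mulrA p_fun_odd.
Qed.

Let sE n x : x <= 1 ->
  s n.+1 x = 1 + \int[lebesgue_measure]_(y in `[0, x]) t n y.
Proof.
move=> x1.
rewrite (Rintegral_sum_unit lebesgue_unit_fin (fun k => (- L) ^+ k.+1) _ x1
  (fun k => bounded_measurable_p_fun (2 * k).+1)).
rewrite /s big_ord_recl expr0 mul1r; congr (_ + _).
by apply: eq_bigr => k _; rewrite -p_fun_even.
Qed.

(** Each induction step integrates the error twice. The [mu]-integral contributes a factor L, as
    [mu] has mass at most 1 on [0,y]; the Lebesgue integral of y^n contributes x^(n+1) / (n+1),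
    which builds the factorial. *)
Lemma neumann_remainder : 0 <= L ->
  exists M : R, forall n (x : R), 0 <= x <= 1 ->
  `|f x - f 0 * \sum_(k < n) (- L) ^+ k * p_fun mu (2 * k) x|
  <= M * (L * x) ^+ n / n`!%:R.
Proof.
move=> L0; have [_ [M hM]] := bf; exists M => n.
elim: n => [|n IH] x x01.
  by rewrite big_ord0 mulr0 subr0 fact0 divr1 mulr1 hM.
have M0 : 0 <= M by apply: le_trans (hM 0 _); rewrite ?lexx ?ler01.
(* Half a step, for the derivative: the exponent of L has risen to n+1 while that of y is still
   n. *)
have IH' y : 0 <= y <= 1 -> `|f' y - f 0 * t n y| <=
    M * L ^+ n.+1 / n`!%:R * y ^+ n.
  move=> y01; have /andP[y0 y1] := y01.
  rewrite f'E// tE// mulrCA -mulrBr -[f 0 * _]opprK -mulNr.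
  rewrite opprK -RintegralZ_unit// -RintegralD_unit//; last first.
    exact: bounded_measurableZ.
  rewrite normrM normrN (ger0_norm L0).
  have C0 : 0 <= M * (L * y) ^+ n / n`!%:R.
    by rewrite divr_ge0// mulr_ge0// exprn_ge0// mulr_ge0.
  apply: (@le_trans _ _ (L * (M * (L * y) ^+ n / n`!%:R *
     fine (mu (segment R 0 y))))).
    rewrite ler_wpM2l// Rintegral_le_cst//.
      by apply: bounded_measurableD => //; exact: bounded_measurableZ.
    (* The inductive bound increases with the point, so on [0,y] its value at y serves as the
       constant. *)
    move=> z /andP[z0 zy]; rewrite mulNr; apply: (le_trans (IH _ _)).
      by rewrite z0 (le_trans zy).
    rewrite ler_wpM2r// ler_wpM2l// lerXn2r ?nnegrE ?mulr_ge0//.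
    by rewrite ler_wpM2l.
  have m1 : fine (mu (segment R 0 y)) <= 1.
    rewrite -[leRHS](_ : fine 1%E = 1)// -mu1 fine_le ?fin_num_unit//.
    by apply: le_measure; rewrite ?inE//; exact: subset_unit_itv.
  apply: (@le_trans _ _ (L * (M * (L * y) ^+ n / n`!%:R * 1))).
    by rewrite ler_wpM2l// ler_wpM2l.
  by rewrite exprMn exprS le_eqVlt; apply/orP; left; apply/eqP; ring.
have /andP[x0 x1] := x01.
(* The terms f(0) cancel, leaving the Lebesgue integral of the error estimated in [IH']. *)
rewrite -/(s n.+1 x) fE// sE// mulrDr mulr1.
rewrite opprD addrACA subrr add0r -mulNr.
rewrite -(RintegralZ_unit lebesgue_unit_fin)//.
rewrite -(RintegralD_unit lebesgue_unit_fin)//; last exact: bounded_measurableZ.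
pose g y := f' y + (- f 0) * t n y.
have ig : (lebesgue_measure : borel_measure R).-integrable
    (segment R 0 x) (EFin \o g).
  apply: integrable_sub_unit => //.
  apply: (bounded_measurable_integrable lebesgue_unit_fin).
  by apply: bounded_measurableD => //; exact: bounded_measurableZ.
have bX : bounded_measurable (fun y : R => y ^+ n).
  split; first exact: measurable_funX.
  exists 1 => y /andP[y0 y1].
  by rewrite ger0_norm ?exprn_ge0// exprn_ile1.
apply: le_trans (le_normr_Rintegral _ ig) _ => //.
apply: (@le_trans _ _ (\int[lebesgue_measure]_(y in `[0, x])
   (M * L ^+ n.+1 / n`!%:R * y ^+ n))).
  apply: le_Rintegral => //.
  - exact: (integrable_norm ig).
  - apply: integrable_sub_unit => //.
    apply: (bounded_measurable_integrable lebesgue_unit_fin).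
    exact: bounded_measurableZ.
  - move=> y; rewrite /= in_itv/= /g mulNr => /andP[y0 yx].
    by apply: IH'; rewrite y0 (le_trans yx).
rewrite (RintegralZ_unit lebesgue_unit_fin)// Rintegral_exprn//.
rewrite exprMn factS natrM invfM le_eqVlt; apply/orP; left; apply/eqP; ring.
Qed.

(** The remainder bound is M times a term of the exponential series at L x, which tends to 0. *)
Lemma cvg_neumann_series (x : R) : 0 <= L -> 0 <= x <= 1 ->
  (f 0 * \sum_(k < n) (- L) ^+ k * p_fun mu (2 * k) x) @[n --> \oo] --> f x.
Proof.
move=> L0 x01; have [M HM] := neumann_remainder L0.
have e0 : M * exp_coeff (L * x) n @[n --> \oo] --> (0 : R).
  by rewrite -(mulr0 M); apply: cvgM; [exact: cvg_cst|exact: cvg_exp_coeff].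
apply: (@squeeze_cvgr _ _ _ _ (fun n => f x - M * exp_coeff (L * x) n)
  (fun n => f x + M * exp_coeff (L * x) n)).
- by apply: nearW => n; rewrite -ler_distlC /exp_coeff/= mulrA HM.
- by rewrite -[X in _ --> X]subr0; apply: cvgB => //; exact: cvg_cst.
- by rewrite -[X in _ --> X]addr0; apply: cvgD => //; exact: cvg_cst.
Qed.

(** Uniqueness for the initial value problem: if f(0) = 0, all partial sums vanish and so does their
    limit f(x). *)
Lemma neumann_solution_neq0 : 0 <= L ->
  (exists2 x : R, 0 <= x <= 1 & f x != 0) -> f 0 != 0.
Proof.
move=> L0 [x x01]; apply: contra_neq => f0.
have := cvg_neumann_series L0 x01; rewrite f0.
under eq_fun do rewrite mul0r.
by move=> /cvg_lim <- //; rewrite lim_cst.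
Qed.


Lemma c_fun_neumann_solution (x : R) : 0 <= L -> 0 <= x <= 1 -> f 0 != 0 ->
  c_fun mu (Num.sqrt L) x = f x / f 0.
Proof.
move=> L0 x01 f0; apply/cvg_lim => //.
have -> : series (fun n =>
      (-1) ^+ n * Num.sqrt L ^+ (2 * n) * p_fun mu (2 * n) x) =
    (fun n => (f 0)^-1 * (f 0 * \sum_(k < n) (- L) ^+ k * p_fun mu (2 * k) x)).
  apply/funext => n; rewrite mulKf// /series/= big_mkord.
  (* As L >= 0, the square of [Num.sqrt L] is L, so the k-th coefficient is (-L)^k. *)
  by apply: eq_bigr => k _; rewrite exprM sqr_sqrtr// -exprMn mulN1r.
rewrite mulrC; apply: cvgM; [exact: cvg_cst|exact: cvg_neumann_series].
Qed.

End NeumannSolution.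
End Series.

(** * The reflection of [0,1] and integrals against symmetric measures *)

Section Reflection.
Context {R : realType}.

Local Notation unit_itv := (segment R 0 1).

Definition reflection (t : measurableTypeR R) : measurableTypeR R :=
  (1 - (t : R))%R.

Lemma measurable_reflection (D : set (measurableTypeR R)) :
  measurable_fun D reflection.
Proof. exact: measurable_funB. Qed.

Lemma preimage_reflection_itv (a b : R) :
  reflection @^-1` (segment R a b) = segment R (1 - b) (1 - a).
Proof.
apply/seteqP; split => t /=; rewrite !in_itv/= /reflection => /andP[? ?];
  apply/andP; split; lra.
Qed.

Lemma bounded_measurable_reflection (h : R -> R) : bounded_measurable h ->
  bounded_measurable (fun x => h (1 - x)).
Proof.
have sub (x : R) : 0 <= x <= 1 -> 0 <= 1 - x <= 1.
  by move=> /andP[? ?]; apply/andP; split; lra.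
move=> [mh [M hM]]; split; last by exists M => x x01; exact/hM/sub.
apply: (measurable_comp (F := unit_itv) (f := h) (g := reflection)) => //.
- by move=> _ [t + <-] /=; rewrite !in_itv/=; exact: sub.
- exact: measurable_reflection.
Qed.

Section SymmetricMeasure.
Context {nu : borel_measure R} (nu_fin : (nu unit_itv < +oo)%E)
  (nu_sym : symmetric_measure nu).

(** Symmetry is assumed for intervals touching the endpoints only. It extends to Borel sets by
    uniqueness of measures: half-lines [x,+oo[ are stable under intersection and generate the Borel
    sets. *)
Lemma measure_reflection (A : set (measurableTypeR R)) : measurable A ->
  A `<=` unit_itv -> nu (reflection @^-1` A) = nu A.
Proof.
have mU : measurable unit_itv by [].
move=> mA AU.
(* Both measures are cut down to [0,1], since nothing is known about [nu] outside; this also makes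
   them finite. *)
suff : mrestr nu mU A = pushforward (mrestr nu mU) reflection A.
  rewrite /pushforward /mrestr !setIidl// => x /AU /=.
  rewrite !in_itv/= /reflection.
  by move=> /andP[? ?]; apply/andP; split; lra.
apply: (@measure_unique _ R (measurableTypeR R) (@RGenCInfty.G R)
  (fun n => `[- (n%:R : R), +oo[%classic)) => //.
- exact: RGenCInfty.measurableE.
- move=> _ _ [x ->] [y ->]; exists (Num.max x y).
  by apply/seteqP; split => t /=; rewrite !in_itv/= !andbT ge_max => /andP.
- by move=> n; exists (- n%:R).
- apply/seteqP; split => // t _ /=.
  exists (Num.truncn `|t|).+1 => //=; rewrite in_itv/= andbT.
  by rewrite lerNl (le_trans _ (ltW (truncnS_gt _)))// -normrN ler_norm.
- exact: measurable_reflection.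
- move=> mr _ [x ->].
  change (nu (`[x, +oo[%classic `&` unit_itv) =
    nu (reflection @^-1` `[x, +oo[%classic `&` unit_itv)).
  (* For x <= 0 both sets are [0,1]; for 0 < x <= 1 they are [x,1] and [0,1-x], matched by symmetry
     at 1 - x; for x > 1 both are empty. *)
  have [x0|x0] := leP x 0.
    congr (nu _); apply/seteqP; split => t /=;
      rewrite !in_itv/= /reflection !andbT => -[? /andP[? ?]]; split;
      rewrite ?in_itv/=; lra.
  have [x1|x1] := leP x 1.
    rewrite (_ : `[x, +oo[%classic `&` unit_itv =
        segment R (1 - (1 - x)) 1); last first.
      apply/seteqP; split => t /=; rewrite !in_itv/= ?andbT.
        by move=> [? /andP[? ?]]; apply/andP; split; lra.
      by move=> /andP[? ?]; split; [|apply/andP; split]; lra.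
    rewrite -nu_sym; last by apply/andP; split; lra.
    congr (nu _); apply/seteqP; split => t /=;
      rewrite !in_itv/= /reflection ?andbT.
      by move=> /andP[? ?]; split; [|apply/andP; split]; lra.
    by move=> [? /andP[? ?]]; apply/andP; split; lra.
  congr (nu _); apply/seteqP; split => t /=;
    rewrite !in_itv/= /reflection !andbT => -[? /andP[? ?]]; lra.
- move=> n; apply: le_lt_trans nu_fin.
  apply: (@le_measure _ _ _ nu); rewrite ?inE//.
  exact: measurableI.
Qed.

Lemma Rintegral_reflection (h : R -> R) (x : R) : 0 <= x <= 1 ->
  measurable_fun unit_itv h ->
  \int[nu]_(t in `[0, x]) h (1 - t) = \int[nu]_(t in `[1 - x, 1]) h t.
Proof.
move=> /andP[x0 x1] mh; rewrite /Rintegral; congr fine.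
have sub : segment R (1 - x) 1 `<=` unit_itv.
  by apply: subset_unit_itv => //; lra.
have meh : measurable_fun (segment R (1 - x) 1) (EFin \o h).
  by apply/measurable_EFinP; exact: measurable_funS mh.
(* Change of variables for nonnegative g; it is then applied to the positive and negative parts of
   h. The image of [nu] is compared with [nu] only on subsets of [1-x,1]. *)
have key (g : R -> \bar R) : measurable_fun (segment R (1 - x) 1) g ->
    (forall t, (0 <= g t)%E) ->
    (\int[nu]_(t in segment R 0 x) (g \o reflection) t =
     \int[nu]_(t in segment R (1 - x) 1) g t)%E.
  move=> mg g0.
  rewrite (_ : segment R 0 x = reflection @^-1` segment R (1 - x) 1); last first.
    by rewrite preimage_reflection_itv subrr subKr.
  rewrite -(@ge0_integral_pushforward _ _ _ _ R reflection _ nu _ g)//.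
    apply: eq_measure_integral => [|mr A mA AS].
      exact: measurable_reflection.
    exact: measure_reflection mA (subset_trans AS sub).
  exact: measurable_reflection.
transitivity
  (\int[nu]_(t in segment R 0 x) ((EFin \o h) \o reflection) t)%E => //.
have keyp := key _ (measurable_funepos meh) (funepos_ge0 (EFin \o h)).
have keyn := key _ (measurable_funeneg meh) (funeneg_ge0 (EFin \o h)).
by rewrite [LHS]integralE [RHS]integralE funepos_comp funeneg_comp keyp keyn.
Qed.

(** This expresses the reflected integral through integrals starting at 0, the form of the equations
    for f and f'. The point 1 - x, common to both closed intervals, has measure 0. *)
Lemma Rintegral_reflectionB (h : R -> R) (x : R) : nonatomic nu ->
  0 <= x <= 1 -> bounded_measurable h ->
  \int[nu]_(t in `[0, x]) h (1 - t) =
  \int[nu]_(t in `[0, 1]) h t - \int[nu]_(t in `[0, 1 - x]) h t.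
Proof.
move=> nu0 x01 bh; have [mh _] := bh.
rewrite Rintegral_reflection//; have /andP[x0 x1] := x01.
have ih := bounded_measurable_integrable nu_fin bh.
have y0 : 0 <= 1 - x by lra.
have y1 : 1 - x <= 1 by lra.
have E1 : segment R 0 1 = segment R 0 (1 - x) `|` `]1 - x, 1]%classic.
  apply/seteqP; split => t /=; rewrite !in_itv/=.
    move=> /andP[? ?]; have [?|?] := leP t (1 - x); [left|right];
    by apply/andP; split; lra.
  by move=> [|] /andP[? ?]; apply/andP; split; lra.
have E2 : `]1 - x, 1]%classic = segment R (1 - x) 1 `\` [set 1 - x].
  apply/seteqP; split => t /=; rewrite !in_itv/=.
    by move=> /andP[? ?]; split; [apply/andP; split; lra|move=> ?; lra].
  move=> [/andP[? ?] /eqP ?]; apply/andP; split; lra.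
have -> : \int[nu]_(t in `[1 - x, 1]) h t = \int[nu]_(t in `]1 - x, 1]) h t.
  rewrite E2 /Rintegral; congr fine; apply: negligible_integral => //.
  exact: integrable_sub_unit.
have iU : nu.-integrable
    (segment R 0 (1 - x) `|` `]1 - x, 1]%classic) (EFin \o h).
  by rewrite -E1.
have dU : [disjoint segment R 0 (1 - x) & `]1 - x, 1]%classic]%classic.
  apply/disj_setPS => t [] /=.
  by rewrite !in_itv/= => /andP[_ +] /andP[+ _]; lra.
have mA : measurable (segment R 0 (1 - x)) by [].
have mB : measurable (`]1 - x, 1]%classic : set (measurableTypeR R)) by [].
have := Rintegral_setU mA mB iU dU.
by rewrite -E1 => ->; rewrite addrAC subrr add0r.
Qed.

End SymmetricMeasure.

Lemma symmetric_lebesgue :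
  symmetric_measure (lebesgue_measure : borel_measure R).
Proof.
move=> x /andP[x0 x1]; rewrite [LHS]lebesgue_measure_0x//.
rewrite [RHS]lebesgue_measure_itv/= lte_fin.
(* The second case is x = 0, where [1-x,1] is a single point. *)
case: ifPn => [_|]; rewrite -?EFinB; first by congr _%:E; ring.
by rewrite -leNgt => ?; congr _%:E; lra.
Qed.

Lemma nonatomic_lebesgue : nonatomic (lebesgue_measure : borel_measure R).
Proof. exact: lebesgue_measure_set1. Qed.

End Reflection.

(** * Symmetry or antisymmetry of the eigenfunctions *)

Theorem corollary6p6 (R : realType)
    (mu : probability (measurableTypeR R) R)
    (mu_unit : on_unit_interval mu)
    (mu_nonatomic : nonatomic mu)
    (mu_sym : symmetric_measure mu)
    (lam : R^nat)
    (lamE : neumann_eigenvalue_sequence mu lam)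
    (m : nat) :
  (forall x : R, 0 <= x <= 1 ->
     neumann_eigenfunction mu lam m x = neumann_eigenfunction mu lam m (1 - x))
  \/
  (forall x : R, 0 <= x <= 1 ->
     neumann_eigenfunction mu lam m x
     = - neumann_eigenfunction mu lam m (1 - x)).
Proof.
have mu1 : mu (segment R 0 1) = 1%E := mu_unit.
have mu_fin : (mu (segment R 0 1) < +oo)%E by rewrite mu1 ltry.
have [f [f' [f_neq0 [[L2f' fE] _] [L2f f'E] f'0 f'1]]] :
    neumann_eigenvalue mu (lam m).
  by have [_ /seteqP[+ _]] := lamE; apply; exists m.
rewrite /neumann_eigenfunction; move: (lam m) => L in L2f f'E *.
(* If L <= 0, every term of index at least 1 contains a positive power of 0, so the series does not
   depend on x. *)
have [L0|/ltW L0] := leP L 0.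
  left=> x _; rewrite ler0_sqrtr//.
  congr (limn _); apply/funext => n; apply: eq_bigr => -[|k] _ //.
  by rewrite expr0n mulr0 !mul0r.
(* f' comes first: it is an indefinite integral of a function in L2(mu), and f is then one of f'. *)
have bf' : bounded_measurable f'.
  apply: (eq_bounded_measurable (fun x x01 => esym (f'E x x01))).
  apply: bounded_measurableD; first exact: bounded_measurable_cst.
  exact/bounded_measurable_Rintegral/L2_unit_integrable.
have bf : bounded_measurable f.
  apply: (eq_bounded_measurable (fun x x01 => esym (fE x x01))).
  apply: bounded_measurableD; first exact: bounded_measurable_cst.
  apply: bounded_measurable_Rintegral.
  exact: (bounded_measurable_integrable lebesgue_unit_fin bf').
have {}f'E x : 0 <= x <= 1 -> f' x = - L * \int[mu]_(t in `[0, x]) f t.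
  move=> x01; have /andP[_ x1] := x01.
  by rewrite f'E// f'0 add0r (RintegralZ_unit mu_fin).
have sub (x : R) : 0 <= x <= 1 -> 0 <= 1 - x <= 1.
  by move=> /andP[? ?]; apply/andP; split; lra.
have i0 : 0 <= (0 : R) <= 1 by rewrite lexx ler01.
have i1 : 0 <= (1 : R) <= 1 by rewrite lexx ler01.
(* The factor -1 is kept as a product so that linearity of the integral applies to [g'] directly. *)
pose g x := f (1 - x); pose g' x := -1 * f' (1 - x).
have bg : bounded_measurable g by exact: bounded_measurable_reflection.
have bg' : bounded_measurable g'.
  by apply: bounded_measurableZ; exact: bounded_measurable_reflection.
have gE x : 0 <= x <= 1 -> g x = g 0 + \int[lebesgue_measure]_(t in `[0, x]) g' t.
  move=> x01; have /andP[_ x1] := x01.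
  rewrite (RintegralZ_unit lebesgue_unit_fin)//; last first.
    exact: bounded_measurable_reflection.
  rewrite (Rintegral_reflectionB lebesgue_unit_fin symmetric_lebesgue
    nonatomic_lebesgue)//.
  rewrite /g subr0 (fE _ i1) (fE _ (sub _ x01)); ring.
(* Here f'(1) = 0 enters: by symmetry of [mu] the right side is f'(1) - f'(1-x). *)
have g'E x : 0 <= x <= 1 -> g' x = - L * \int[mu]_(t in `[0, x]) g t.
  move=> x01; rewrite (Rintegral_reflectionB mu_fin mu_sym)//.
  by rewrite mulrBr -(f'E _ i1) -f'E ?sub// f'1 sub0r /g' mulN1r.
have f0 : f 0 != 0 := neumann_solution_neq0 mu1 bf bf' fE f'E L0 f_neq0.
(* f(1) is the initial value of the reflected solution [g], which is not identically zero on
   [0,1]. *)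
have f1 : f 1 != 0.
  have : g 0 != 0.
    apply: (neumann_solution_neq0 mu1 bg bg' gE g'E L0).
    have [x x01 fx] := f_neq0; exists (1 - x); first exact: sub.
    by rewrite /g subKr.
  by rewrite /g subr0.
have cf x : 0 <= x <= 1 -> c_fun mu (Num.sqrt L) x = f x / f 0.
  by move=> x01; exact: (c_fun_neumann_solution mu1 bf bf' fE f'E).
have cg x : 0 <= x <= 1 -> c_fun mu (Num.sqrt L) x = f (1 - x) / f 1.
  move=> x01; have := c_fun_neumann_solution mu1 bg bg' gE g'E L0 x01.
  by rewrite /g subr0; exact.
(* At x = 1 the two formulas for c give f(1) / f(0) = f(0) / f(1). *)
have : f 0 ^+ 2 == f 1 ^+ 2.
  have := cg _ i0; rewrite cf// subr0 !divff//.
  have := cg _ i1; rewrite cf// subrr => /eqP.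
  by rewrite eqr_div// => /eqP e _; apply/eqP; rewrite !expr2 e.
(* By [cg], c(x) is f(1-x) / f(1); by [cf], c(1-x) is f(1-x) / f(0). The numerators agree, so the
   sign relating f(0) to f(1) decides the symmetry. *)
rewrite eqf_sqr => /orP[|] /eqP e; [left|right] => x x01;
  rewrite cg// cf ?sub// e //.
by rewrite invrN mulrN opprK.
Qed.
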